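(* Define $\xi:[\frac12,1]\to[0,2]$ by $$\xi(\gamma)=2-\log_2\gamma-\frac1\gamma\sum_{k=1}^\infty\frac{k\,\varepsilon_k}{2^k},$$ where $(\varepsilon_k)_{k\ge0}\subseteq\{0,1\}$ is the sequence of digits of the dyadic expansion $\gamma=\sum_{k=0}^\infty\frac{\varepsilon_k}{2^k}$ of $\gamma$, chosen such that $\varepsilon_k=0$ for infinitely many $k$. Let $G_\xi([\frac12,1])=\{(\gamma,\xi(\gamma)):\gamma\in[\frac12,1]\}\subseteq\mathbb{R}^2$ be its graph. Then the box-counting dimension of $G_\xi([\frac12,1])$ exists and $$\dim_{\rm H}G_\xi([\tfrac12,1])=1=\dim_{\rm B}G_\xi([\tfrac12,1]).$$
   Context: $\dim_{\rm H}$ denotes Hausdorff dimension. For a bounded set $F\subseteq\mathbb{R}^d$ let $N_\delta(F)$ be the smallest number of closed balls of radius $\delta$ that cover $F$; the box-counting dimension is $\dim_{\rm B}F=\lim_{\delta\to0}\frac{\log N_\delta(F)}{-\log\delta}$, provided the limit exists. $\log_2$ is the logarithm to base $2$. For $\gamma=1$ the digits are $\varepsilon_0=1$ and $\varepsilon_k=0$ for $k\ge1$; for $\gamma\in[\frac12,1)$ one has $\varepsilon_0=0$ and $\varepsilon_1=1$. *)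

(* Defs.v *)
From HB Require Import structures.
From mathcomp Require Import all_boot all_order all_algebra.
From mathcomp Require Import all_classical all_reals all_analysis.
Set Implicit Arguments.
Unset Strict Implicit.
Unset Printing Implicit Defensive.
Import Order.TTheory GRing.Theory Num.Theory.
Import numFieldNormedType.Exports.
Local Open Scope classical_set_scope.
Local Open Scope ring_scope.

Section EuclideanSpace.
Context {R : realType} {d : nat}.
Implicit Types (F U : set 'rV[R]_d) (s delta : R).

(* The norm `|x| that MathComp-Analysis puts on 'rV[R]_d is the sup norm. *)
Definition enorm (x : 'rV[R]_d) : R := Num.sqrt (\sum_(i < d) x 0 i ^+ 2).

Definition ecball (c : 'rV[R]_d) delta : set 'rV[R]_d :=
  [set x | enorm (x - c) <= delta].

Definition ediam U : \bar R :=
  ereal_sup [set (enorm (x - y))%:E | x in U & y in U].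

(* |U|^s. The empty set contributes 0 also for s = 0, whereas a singleton
   contributes 0 `^ 0 = 1 then; note that ediam set0 = -oo. *)
Definition diam_pow s U : \bar R :=
  if U == set0 then 0%E else poweR (ediam U) s.

Definition delta_cover delta F (U : nat -> set 'rV[R]_d) : Prop :=
  F `<=` \bigcup_i U i /\ forall i, (ediam (U i) <= delta%:E)%E.

Definition hausdorff_premeasure s delta F : \bar R :=
  ereal_inf [set (\sum_(0 <= i <oo) diam_pow s (U i))%E
            | U in [set U | delta_cover delta F U]].

(* The premeasure is nonincreasing in delta, so this supremum is its limit as
   delta tends to 0. *)
Definition hausdorff_measure s F : \bar R :=
  ereal_sup [set hausdorff_premeasure s delta F
            | delta in [set delta : R | 0 < delta]].

Definition hausdorff_dim F : \bar R :=
  ereal_inf [set s%:E | s in [set s : R | 0 <= s /\ hausdorff_measure s F = 0%E]].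

Definition ball_coverable delta F (n : nat) : Prop :=
  exists c : 'I_n -> 'rV[R]_d, F `<=` \bigcup_(i in [set: 'I_n]) ecball (c i) delta.

(* Junk value 0 if no finite cover exists, i.e. if F is unbounded. *)
Definition covering_number delta F : nat :=
  xget 0%N [set n | ball_coverable delta F n /\
                    forall m, ball_coverable delta F m -> (n <= m)%N].

Definition box_ratio F delta : R :=
  ln (covering_number delta F)%:R / - ln delta.

Definition box_dim_exists F : Prop := cvg (box_ratio F delta @[delta --> 0^'+]).

(* Meaningful only if box_dim_exists F holds. *)
Definition box_dim F : R := lim (box_ratio F delta @[delta --> 0^'+]).

End EuclideanSpace.

Section Xi.
Context {R : realType}.
Implicit Types (gamma : R) (eps : nat -> bool).

Definition dyadic_expansion gamma eps : Prop :=
  (series (fun k => (eps k)%:R / 2 ^+ k) @ \oo --> gamma) /\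
  infinite_set [set k | eps k = false].

(* Every gamma in [0, 2[ has exactly one such expansion. *)
Definition digits gamma : nat -> bool := get [set eps | dyadic_expansion gamma eps].

Definition log2 (x : R) : R := ln x / ln 2.

Definition xi gamma : R :=
  2 - log2 gamma
  - gamma^-1 * limn (fun n => \sum_(1 <= k < n) k%:R * (digits gamma k)%:R / 2 ^+ k : R).

Definition graph_on (f : R -> R) (A : set R) : set 'rV[R]_2 :=
  [set \row_(i < 2) (if i == 0 then x else f x) | x in A].

End Xi.

(* Main.v *)
(** Points whose dyadic expansions share the first n digits lie at distance
    O(2^-n), and telescoping k/2^k = 2(k+1)/2^k - 2(k+2)/2^(k+1) shows that
    their values under xi differ by O(n 2^-n).  So the part of the graph above
    each of the 2^n digit prefixes is covered by O(n) balls of radius O(2^-n),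
    and O(n 2^n) balls cover the graph: the factor n is invisible in the
    logarithmic ratio.  Conversely, the graph projects onto [1/2, 1], so by
    subadditivity of Lebesgue measure the diameters of any cover have a sum
    bounded below, which gives both lower bounds.  The upper bound for the
    Hausdorff dimension is the general inequality with the box dimension. *)
Require Import Defs.
From HB Require Import structures.
From mathcomp Require Import all_boot all_order all_algebra.
From mathcomp Require Import all_classical all_reals all_analysis.
From mathcomp Require Import ring lra zify.
Import Order.TTheory GRing.Theory Num.Theory.
Import numFieldNormedType.Exports.
Local Open Scope classical_set_scope.
Local Open Scope ring_scope.

(** * Tail estimates for digit series, and existence of dyadic expansions *)

Section DigitSums.
Context {R : realType}.

(** [T] plays the role of the tail of the series of [a]: only terms with k >= n can differ, each by
    at most [a k], and these bounds telescope to [T n - T m]. *)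
Lemma digit_sum_le (a T : nat -> R) (e f : nat -> bool) (n m : nat) :
  (forall k, 0 <= a k) -> (forall k, a k = T k - T k.+1) -> (forall k, 0 <= T k) ->
  (forall k, (k < n)%N -> e k = f k) ->
  `|\sum_(0 <= k < m) a k * (e k)%:R - \sum_(0 <= k < m) a k * (f k)%:R| <= T n.
Proof.
move=> a0 aT T0 ef.
have [mn|/ltnW nm] := leqP m n.
  rewrite (_ : _ - _ = 0) ?normr0//; apply/eqP; rewrite subr_eq0; apply/eqP.
  apply: eq_big_nat => k /andP[_ km]; rewrite ef//; exact: leq_trans km mn.
suff H : `|\sum_(0 <= k < m) a k * (e k)%:R - \sum_(0 <= k < m) a k * (f k)%:R|
    <= T n - T m by rewrite (le_trans H)// gerBl.
elim: m nm => [|m IH].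
  rewrite leqn0 => /eqP ->; by rewrite !big_nil !subrr normr0.
rewrite leq_eqVlt => /orP[/eqP nm|].
  rewrite nm subrr (_ : _ - _ = 0) ?normr0//; apply/eqP; rewrite subr_eq0.
  by apply/eqP; apply: eq_big_nat => k /andP[_ km]; rewrite ef// nm.
rewrite ltnS => nm; have {}IH := IH nm.
rewrite !big_nat_recr//= opprD addrACA -mulrBr.
rewrite (le_trans (ler_normD _ _))//.
have -> : T n - T m.+1 = (T n - T m) + a m by rewrite aT; ring.
rewrite lerD// normrM (ger0_norm (a0 m)) ler_piMr//.
by case: (e m); case: (f m); rewrite ?subrr ?subr0 ?sub0r ?normrN ?normr0 ?normr1.
Qed.

Lemma digit_sum_cvg (a T : nat -> R) (e : nat -> bool) :
  (forall k, 0 <= a k) -> (forall k, a k = T k - T k.+1) -> (forall k, 0 <= T k) ->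
  cvgn (fun m => \sum_(0 <= k < m) a k * (e k)%:R).
Proof.
move=> a0 aT T0; apply: nondecreasing_is_cvgn.
  apply/nondecreasing_seqP => m; rewrite big_nat_recr//= lerDl.
  by rewrite mulr_ge0.
exists (T 0%N) => _ [m _ <-].
(* Comparing with the zero digits, with no agreement required (n = 0), bounds every partial sum by
   [T 0]. *)
have := @digit_sum_le a T e (fun=> false) 0 m a0 aT T0.
rewrite [X in _ - X]big1 ?subr0; last by move=> k _; rewrite mulr0.
by move=> H; apply: le_trans (ler_norm _) (H _).
Qed.

Lemma digit_sum_lim_le (a T : nat -> R) (e f : nat -> bool) (n : nat) :
  (forall k, 0 <= a k) -> (forall k, a k = T k - T k.+1) -> (forall k, 0 <= T k) ->
  (forall k, (k < n)%N -> e k = f k) ->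
  `|limn (fun m => \sum_(0 <= k < m) a k * (e k)%:R)
    - limn (fun m => \sum_(0 <= k < m) a k * (f k)%:R)| <= T n.
Proof.
move=> a0 aT T0 ef.
have ce := @digit_sum_cvg a T e a0 aT T0.
have cf := @digit_sum_cvg a T f a0 aT T0.
rewrite -limB// -lim_norm; last exact: is_cvgB.
apply: limr_le; first by apply: is_cvg_norm; exact: is_cvgB.
by apply: nearW => m; exact: digit_sum_le.
Qed.

Definition weighted_digit_sum (gamma : R) : R :=
  limn (fun n => \sum_(1 <= k < n) k%:R * (digits gamma k)%:R / 2 ^+ k : R).

Lemma weighted_digit_sumE gamma : weighted_digit_sum gamma =
  limn (fun n => \sum_(0 <= k < n) (k%:R / 2 ^+ k) * (digits gamma k)%:R : R).
Proof.
congr (limn _); apply/funext => -[|n]; first by rewrite !big_nil.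
rewrite [RHS]big_ltn// !mul0r add0r; apply: eq_bigr => k _; exact: mulrAC.
Qed.

Lemma expansion_limE (gamma : R) e : dyadic_expansion gamma e ->
  gamma = limn (fun n => \sum_(0 <= k < n) 2^-1 ^+ k * (e k)%:R : R).
Proof.
move=> [/cvg_lim <-// _]; congr (limn _); apply/funext => n.
by rewrite /series/=; apply: eq_bigr => k _; rewrite mulrC exprVn.
Qed.

Lemma expansion_diff_le (gamma gamma' : R) e f n :
  dyadic_expansion gamma e -> dyadic_expansion gamma' f ->
  (forall k, (k < n)%N -> e k = f k) -> `|gamma - gamma'| <= 2 / 2 ^+ n.
Proof.
move=> /expansion_limE -> /expansion_limE -> ef.
apply: (@digit_sum_lim_le _ (fun n => 2 / 2 ^+ n)) => //.
by move=> k; rewrite exprVn exprS; field; rewrite expf_neq0.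
Qed.

(** The quantity 2 (k + 1) / 2^k is the exact tail of the series of j / 2^j over j >= k. *)
Lemma half_pow_telescope (k : nat) : k%:R / 2 ^+ k =
  2 * k.+1%:R / 2 ^+ k - 2 * k.+2%:R / 2 ^+ k.+1 :> R.
Proof.
rewrite exprS -[k.+2]addn2 -[k.+1]addn1 !natrD; field.
by rewrite expf_neq0.
Qed.

Lemma weighted_digit_sum_diff_le (gamma gamma' : R) n :
  (forall k, (k < n)%N -> digits gamma k = digits gamma' k) ->
  `|weighted_digit_sum gamma - weighted_digit_sum gamma'| <= 2 * n.+1%:R / 2 ^+ n.
Proof.
move=> ef; rewrite !weighted_digit_sumE.
apply: (@digit_sum_lim_le _ (fun n => 2 * n.+1%:R / 2 ^+ n)) => //.
exact: half_pow_telescope.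
Qed.

Lemma weighted_digit_sum_le2 gamma : `|weighted_digit_sum gamma| <= 2.
Proof.
rewrite weighted_digit_sumE.
have := @digit_sum_lim_le (fun k => k%:R / 2 ^+ k) (fun n => 2 * n.+1%:R / 2 ^+ n)
  (digits gamma) (fun=> false) 0.
rewrite /= mulr1 expr0 divr1 [X in _ - limn X](_ : _ = cst 0); last first.
  by apply/funext => n; rewrite big1// => k _; rewrite mulr0.
rewrite lim_cst// subr0; apply => //.
exact: half_pow_telescope.
Qed.

(** Since [digits] chooses among the expansions, it suffices to exhibit one. The k-th digit is the
    parity of floor(2^k gamma), so that the digits 0 to m sum to floor(2^m gamma) / 2^m. *)
Lemma digits_expansion (gamma : R) : 0 <= gamma < 2 ->
  dyadic_expansion gamma (digits gamma).
Proof.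
move=> /andP[g0 g2]; rewrite /digits; apply: getPex.
pose t k := Num.truncn (2 ^+ k * gamma).
have tP k : (t k)%:R <= 2 ^+ k * gamma < (t k).+1%:R.
  by apply: truncn_itv; rewrite mulr_ge0// exprn_ge0.
have t0 : t 0%N = odd (t 0%N).
  have /andP[H _] := tP 0%N.
  have : (t 0%N < 2)%N.
    by rewrite -(ltr_nat R); apply: le_lt_trans H _; rewrite expr0 mul1r.
  by case: (t 0%N) => [|[|]].
have tS k : t k.+1 = (odd (t k.+1) + (t k).*2)%N.
  have /andP[H1 H2] := tP k; have /andP[H3 H4] := tP k.+1.
  rewrite -[LHS]odd_double_half; congr (_ + _.*2)%N.
  rewrite exprS -mulrA in H3 H4.
  have A : ((t k).*2 < (t k.+1).+1)%N.
    rewrite -(ltr_nat R) -muln2 natrM; apply: le_lt_trans H4.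
    by rewrite mulrC ler_pM2l.
  have B : (t k.+1 < (t k).+1.*2)%N.
    rewrite -(ltr_nat R) -muln2 natrM; apply: le_lt_trans H3 _.
    by rewrite [ltRHS]mulrC ltr_pM2l.
  have := odd_double_half (t k.+1); lia.
pose eps k := odd (t k).
have psum m : series (fun k => (eps k)%:R / 2 ^+ k) m.+1 = (t m)%:R / 2 ^+ m :> R.
  rewrite /series/=; elim: m => [|m IH].
    by rewrite big_nat1 /eps -t0.
  rewrite big_nat_recr//= IH (tS m) natrD -muln2 natrM exprS -/(eps m.+1).
  field; by rewrite expf_neq0.
have pow_gt0 m : 0 < 2 ^+ m :> R by rewrite exprn_gt0.
have cvg_g : series (fun k => (eps k)%:R / 2 ^+ k) @ \oo --> gamma.
  rewrite -cvg_shiftS /=.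
  apply: (@squeeze_cvgr _ _ _ _ (fun m => gamma - 2^-1 ^+ m) (fun=> gamma)).
  - apply: nearW => m; rewrite psum; have /andP[H1 H2] := tP m.
    rewrite ler_pdivrMr// [gamma * _]mulrC H1 andbT exprVn.
    rewrite ler_pdivlMr// mulrBl mulVf ?lt0r_neq0// lerBlDr natr1 mulrC.
    exact: ltW.
  - rewrite -[X in _ --> X]subr0; apply: cvgB; first exact: cvg_cst.
    by apply: cvg_expr; rewrite ger0_norm// invf_lt1// ltr1n.
  - exact: cvg_cst.
exists eps; split => //.
(* If all digits after the n-th were 1, then gamma would be the right end point
   of its n-th half-open dyadic interval. *)
move=> fin; have [n en] : exists n, forall k, (n < k)%N -> eps k = true.
  have /finite_seqP[s sE] := fin.
  exists (\max_(k <- s) k)%N => k nk; apply: contraTT nk => /negbTE ek.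
  have : (k \in s) by have : [set k | eps k = false] k by []; rewrite sE.
  by move=> ks; rewrite -leqNgt; apply: (@leq_bigmax_seq _ s xpredT id).
(* A digit 1 sends t to 2 t + 1, so t + 1 doubles at every step beyond n. *)
have tn m : (t (n + m)%N).+1 = ((t n).+1 * 2 ^ m)%N.
  elim: m => [|m IH]; first by rewrite addn0 expn0 muln1.
  rewrite addnS tS -/(eps _) en ?ltnS ?leq_addr// expnS mulnCA -IH; lia.
have : gamma < (t n).+1%:R / 2 ^+ n.
  by rewrite ltr_pdivlMr// mulrC; have /andP[] := tP n.
apply/negP; rewrite -leNgt.
rewrite -cvg_shiftS -(cvg_shiftn n) /= in cvg_g.
have Hn : (fun m => series (fun k => (eps k)%:R / 2 ^+ k) (m + n).+1) @ \oo
    --> ((t n).+1%:R / 2 ^+ n - 0 : R).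
  under eq_fun => m.
    rewrite psum addnC (_ : _ / _ = (t n).+1%:R / 2 ^+ n - 2^-1 ^+ n * 2^-1 ^+ m).
      over.
    have : (t (n + m)%N)%:R + 1 = (t n).+1%:R * 2 ^+ m :> R.
      by rewrite natr1 tn natrM natrX.
    move/(canRL (addrK _)) ->; rewrite exprD !exprVn.
    field; by rewrite !expf_neq0.
  apply: cvgB; first exact: cvg_cst.
  rewrite -(mulr0 (2^-1 ^+ n)); apply: cvgM; first exact: cvg_cst.
  by apply: cvg_expr; rewrite ger0_norm// invf_lt1// ltr1n.
have := cvg_unique _ cvg_g Hn; rewrite subr0 => -> //.
Qed.

End DigitSums.

(** * Variation of [xi] between points sharing a digit prefix *)

Section Oscillation.
Context {R : realType}.

(** For y <= x, ln x - ln y = ln (1 + (x - y) / y) <= (x - y) / y, and 1 / y <= 2. *)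
Lemma ln_diff_le (x y : R) : 2^-1 <= x -> 2^-1 <= y ->
  `|ln x - ln y| <= 2 * `|x - y|.
Proof.
wlog yx : x y / y <= x => [H|] x2 y2.
  have /orP[yx|xy] := le_total y x; first exact: H.
  by rewrite distrC [`|x - y|]distrC; apply: H.
have y0 : 0 < y by lra.
have x0 : 0 < x by lra.
rewrite !ger0_norm ?subr_ge0 ?ler_ln//.
rewrite -ln_div// (_ : x / y = 1 + (x - y) / y); last by field; rewrite gt_eqF.
apply: (@le_trans _ _ ((x - y) / y)).
  apply: le_ln1Dx; apply: (@lt_le_trans _ _ 0); first lra.
  by rewrite divr_ge0 ?subr_ge0 // ltW.
rewrite mulrC ler_wpM2r ?subr_ge0//.
by rewrite -[leRHS]invrK lef_pV2 ?posrE// invr_gt0.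
Qed.

(** The logarithm and the factor 1 / gamma are Lipschitz on [1/2, 1] and vary by O(2^-n); only the
    digit series brings in the factor n + 1. *)
Lemma xi_diff_le : exists K : nat, forall n (gamma gamma' : R),
  2^-1 <= gamma <= 1 -> 2^-1 <= gamma' <= 1 ->
  (forall k, (k < n)%N -> digits gamma k = digits gamma' k) ->
  `|gamma - gamma'| <= 2 / 2 ^+ n /\
  `|xi gamma - xi gamma'| <= (K * n.+1)%:R * (2 / 2 ^+ n).
Proof.
have ln2 : 0 < ln 2 :> R by rewrite ln_gt0// ltr1n.
(* The truncation bounds the logarithmic term; 10 = 2 + 8 serves the change of the digit series and
   the change of 1 / gamma. *)
exists ((Num.truncn (2 / ln 2 : R)).+1 + 10)%N => n x y /andP[x2 x1] /andP[y2 y1] xy.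
have xyn : `|x - y| <= 2 / 2 ^+ n.
  apply: (expansion_diff_le _ _ _ _ _ _ _ xy); apply: digits_expansion; lra.
split => //.
have W := weighted_digit_sum_diff_le _ _ _ xy.
have Wy := weighted_digit_sum_le2 y.
have L := ln_diff_le _ _ x2 y2.
have xiE z : xi z = 2 - ln z / ln 2 - z^-1 * weighted_digit_sum z by [].
rewrite !xiE; move: (weighted_digit_sum x) (weighted_digit_sum y) W Wy => u v W Wy.
move: (ln x) (ln y) (ln 2 : R) ln2 L => lx ly l2 ln2 L.
have -> : 2 - lx / l2 - x^-1 * u - (2 - ly / l2 - y^-1 * v) =
    - (lx - ly) / l2 - x^-1 * (u - v) + v * (x - y) / (x * y).
  by field; rewrite !gt_eqF//; lra.
have xV : x^-1 <= 2 by rewrite -[leRHS]invrK lef_pV2 ?posrE//; lra.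
have yV : y^-1 <= 2 by rewrite -[leRHS]invrK lef_pV2 ?posrE//; lra.
have xV0 : 0 <= x^-1 by rewrite invr_ge0; lra.
have yV0 : 0 <= y^-1 by rewrite invr_ge0; lra.
set r : R := 2 / 2 ^+ n in xyn *.
have r0 : 0 <= r by rewrite divr_ge0// exprn_ge0.
have A1 : `|- (lx - ly) / l2| <= (2 / l2) * r.
  rewrite normrM normrN normfV (gtr0_norm ln2) mulrAC ler_wpM2r ?invr_ge0 ?(ltW ln2)//.
  by apply: le_trans L _; rewrite ler_wpM2l.
have A2 : `|x^-1 * (u - v)| <= 2 * (n.+1%:R * r).
  rewrite normrM (ger0_norm xV0) ler_pM//; apply: le_trans W _.
  by rewrite /r mulrCA mulrA.
(* 8 = 2 * 2 * 2, from |v| <= 2 and the bound 2 on each of 1 / x and 1 / y. *)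
have A3 : `|v * (x - y) / (x * y)| <= 8 * r.
  rewrite normrM normrM invfM (ger0_norm (mulr_ge0 xV0 yV0)).
  rewrite (_ : 8 * r = 2 * r * (2 * 2)); last by ring.
  by rewrite ler_pM ?mulr_ge0// ler_pM.
have A4 : 2 / l2 <= (Num.truncn (2 / l2)).+1%:R :> R by exact/ltW/truncnS_gt.
rewrite (le_trans (ler_normD _ _))//.
have A5 := ler_normB (- (lx - ly) / l2)
  (x^-1 * (u - v)).
move: (Num.truncn _).+1 A4 => c A4.
have n1 : 1 <= n.+1%:R :> R by rewrite ler1n.
have A6 : 2 / l2 * r <= c%:R * (n.+1%:R * r).
  rewrite mulrA ler_wpM2r// (le_trans A4)//.
  by rewrite ler_peMr.
have A7 : 8 * r <= 8 * (n.+1%:R * r) by rewrite ler_pM2l// ler_peMl.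
have -> : ((c + 10) * n.+1)%:R * r = (c%:R + 10) * (n.+1%:R * r).
  by rewrite natrM natrD mulrA.
lra.
Qed.

End Oscillation.

(** * Euclidean balls, diameters and finite covers *)

Section Covers.
Context {R : realType}.

Lemma enorm_ge0 d (x : 'rV[R]_d) : 0 <= enorm x.
Proof. exact: sqrtr_ge0. Qed.

Lemma enorm_le d (x : 'rV[R]_d) (r : R) : 0 <= r ->
  (enorm x <= r) = (\sum_(i < d) x 0 i ^+ 2 <= r ^+ 2).
Proof.
move=> r0; have S0 : 0 <= \sum_(i < d) x 0 i ^+ 2 by apply: sumr_ge0 => i _; exact: sqr_ge0.
by rewrite -(ler_sqr (enorm_ge0 _ x)) ?nnegrE// /enorm sqr_sqrtr.
Qed.

Lemma coord_le_enorm d (x : 'rV[R]_d) i : `|x 0 i| <= enorm x.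
Proof.
rewrite -sqrtr_sqr ler_wsqrtr// (bigD1 i)//= lerDl.
by apply: sumr_ge0 => j _; exact: sqr_ge0.
Qed.

Lemma ediam_ecball_le d (c : 'rV[R]_d) (delta : R) : 0 <= delta ->
  (ediam (ecball c delta) <= (2 * delta)%:E)%E.
Proof.
move=> d0; apply: ub_ereal_sup => _ [x xB [y yB <-]]; rewrite lee_fin.
rewrite /ecball/= in xB yB; rewrite enorm_le// in xB; rewrite enorm_le// in yB.
rewrite enorm_le ?mulr_ge0//.
(* Coordinatewise |x - y|^2 <= 2 |x - c|^2 + 2 |y - c|^2 takes the place of the triangle
   inequality. *)
apply: (@le_trans _ _ (\sum_(i < d) (2 * ((x - c) 0 i ^+ 2) + 2 * ((y - c) 0 i ^+ 2)))).
  apply: ler_sum => i _; rewrite !mxE.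
  have := sqr_ge0 (x 0 i + y 0 i - 2 * c 0 i); lra.
by rewrite big_split/= -!mulr_sumr; lra.
Qed.

Lemma ediam_ge0 d (U : set 'rV[R]_d) : U !=set0 -> (0 <= ediam U)%E.
Proof.
move=> [x Ux]; apply: (@le_trans _ _ (enorm (x - x))%:E).
  by rewrite lee_fin enorm_ge0.
by apply: ereal_sup_ubound; exists x => //; exists x.
Qed.

Lemma diam_pow_ge0 d (s : R) (U : set 'rV[R]_d) : (0 <= diam_pow s U)%E.
Proof. by rewrite /diam_pow; case: ifPn => // _; exact: poweR_ge0. Qed.

Lemma diam_pow_le d (s r : R) (U : set 'rV[R]_d) : 0 <= s -> 0 <= r ->
  (ediam U <= r%:E)%E -> (diam_pow s U <= (r `^ s)%:E)%E.
Proof.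
move=> s0 r0 Ur; rewrite /diam_pow; case: ifPn => [_|/set0P /ediam_ge0 U0].
  by rewrite lee_fin powR_ge0.
case: (ediam U) U0 Ur => // u; rewrite poweR_EFin !lee_fin => u0 ur.
by rewrite ge0_ler_powR ?nnegrE.
Qed.

Lemma ball_coverable_delta_cover d (F : set 'rV[R]_d) (s delta : R) n :
  0 <= s -> 0 < delta -> ball_coverable delta F n ->
  exists2 U, delta_cover (2 * delta) F U &
    (\sum_(0 <= i <oo) diam_pow s (U i) <= (n%:R * (2 * delta) `^ s)%:E)%E.
Proof.
move=> s0 d0 [c Fc].
(* The finite family is padded with empty sets, which contribute 0 for every s. *)
pose U i := if insub i is Some j then ecball (c j) delta else set0.
have Ud i : (ediam (U i) <= (2 * delta)%:E)%E.
  rewrite /U; case: insubP => [j _ _|_]; first exact/ediam_ecball_le/ltW.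
  by apply: ub_ereal_sup => _ [x []].
exists U.
  split=> // x /Fc[j _ xj]; exists j => //; by rewrite /U valK.
rewrite (nneseries_split 0 n); last by move=> *; exact: diam_pow_ge0.
rewrite add0n [X in (_ + X)%E]eseries0; last first.
  by move=> i ni _; rewrite /U insubF ?ltnNge ?ni// /diam_pow eqxx.
rewrite adde0 big_mkord.
apply: (@le_trans _ _ (\sum_(i < n) ((2 * delta) `^ s)%:E)%E).
  by apply: lee_sum => i _; apply: diam_pow_le => //; rewrite mulr_ge0// ltW.
by rewrite sumEFin lee_fin sumr_const card_ord (mulr_natl (_ `^ _)).
Qed.

Lemma covering_numberP d (F : set 'rV[R]_d) (delta : R) n : ball_coverable delta F n ->
  ball_coverable delta F (covering_number delta F) /\ (covering_number delta F <= n)%N.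
Proof.
move=> Fn; rewrite /covering_number.
set P := [set _ | _].
have : exists n, P n.
  have ex : exists m, `[< ball_coverable delta F m >] by exists n; exact/asboolP.
  case: (ex_minnP ex) => m /asboolP Fm mP; exists m; split=> // k Fk.
  by apply: mP; exact/asboolP.
by move/(xgetPex 0%N) => [? H]; split=> //; exact: H.
Qed.

(** Above one label class the graph stays within r horizontally and m r vertically of the point
    above a representative, so a column of 2 m + 1 centres at vertical spacing r suffices. *)
Lemma graph_ball_coverable (T : finType) (label : R -> T) (f : R -> R) (A : set R)
    (r : R) (m : nat) : 0 < r ->
  (forall x y, A x -> A y -> label x = label y ->
    `|x - y| <= r /\ `|f x - f y| <= m%:R * r) ->
  ball_coverable (2 * r) (graph_on f A) (#|T| * m.*2.+1).
Proof.
move=> r0 H.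
pose rep (t : T) : R := get [set x | A x /\ label x = t].
pose center (p : T * 'I_m.*2.+1) : 'rV[R]_2 :=
  \row_(i < 2) (if i == 0 then rep p.1 else f (rep p.1) + (p.2%:R - m%:R) * r).
have cE : (#|T| * m.*2.+1)%N = #|{: T * 'I_m.*2.+1}| by rewrite card_prod card_ord.
exists (fun i => center (enum_val (cast_ord cE i))).
move=> _ [x Ax <-].
have [Ay yx] : A (rep (label x)) /\ label (rep (label x)) = label x.
  by apply: (@getPex _ [set y | A y /\ label y = label x]); exists x.
have [xr fr] := H _ _ Ax Ay (esym yx).
set y := rep _ in Ay xr fr *.
(* The height of f x above the lowest centre, in units of r; its integer part selects the centre. *)
pose z := (f x - f y) / r + m%:R.
have zr : (z - m%:R) * r = f x - f y by rewrite /z addrK divfK// gt_eqF.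
move: fr; rewrite ler_norml => /andP[fr1 fr2].
have z0 : 0 <= z.
  by rewrite -(ler_pM2r r0) mul0r -[z](subrK m%:R) mulrDl zr; lra.
have zm : z <= m.*2%:R.
  rewrite -(ler_pM2r r0) -[z](subrK m%:R) mulrDl zr -addnn natrD; lra.
have /andP[j1 j2] := truncn_itv z0.
have jm : (Num.truncn z < m.*2.+1)%N by rewrite ltnS -(ler_nat R) (le_trans j1).
exists (cast_ord (esym cE) (enum_rank (label x, Ordinal jm))) => //.
rewrite cast_ordKV enum_rankK /ecball/= enorm_le; last by rewrite mulr_ge0// ltW.
rewrite big_ord_recl big_ord1 !mxE/= -/y.
have B1 : (x - y) ^+ 2 <= r ^+ 2.
  by rewrite -[leLHS]real_normK ?num_real// ler_sqr ?nnegrE// ltW.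
have B2 : (f x - (f y + ((Num.truncn z)%:R - m%:R) * r)) ^+ 2 <= r ^+ 2.
  rewrite (_ : _ - _ = (z - (Num.truncn z)%:R) * r); last by rewrite -[f x](subrK (f y)) -zr; ring.
  rewrite exprMn ler_piMl ?sqr_ge0// expr_le1// ?subr_ge0// lerBlDl natr1; exact: ltW.
(* Both coordinates are off by at most r, and r^2 + r^2 <= (2 r)^2. *)
have := sqr_ge0 r; lra.
Qed.

End Covers.

(** * Bounds for the Hausdorff and box-counting dimensions *)

Section Dimensions.
Context {R : realType}.

Lemma delta_cover_le d (delta delta' : R) (F : set 'rV[R]_d) U :
  delta <= delta' -> delta_cover delta F U -> delta_cover delta' F U.
Proof.
by move=> dd [FU Ud]; split=> // i; rewrite (le_trans (Ud i))// lee_fin.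
Qed.

Lemma ball_coverable_le d (delta delta' : R) (F : set 'rV[R]_d) n :
  delta <= delta' -> ball_coverable delta F n -> ball_coverable delta' F n.
Proof.
move=> dd [c Fc]; exists c => x /Fc[j _ xj]; exists j => //.
by rewrite /ecball/= (le_trans xj).
Qed.

Lemma hausdorff_premeasure_ge0 d (s delta : R) (F : set 'rV[R]_d) :
  (0 <= hausdorff_premeasure s delta F)%E.
Proof.
apply: le_ereal_inf_tmp => _ [U _ <-].
by apply: nneseries_ge0 => *; exact: diam_pow_ge0.
Qed.

(** For small eta at most eta^-(t + e/2) balls are needed, so the sum with exponent t + e is at most
    2^(t + e) eta^(e/2), which tends to 0. *)
Lemma hausdorff_dim_le_box_dim d (F : set 'rV[R]_d) (t : R) : 0 <= t ->
  (forall delta, 0 < delta -> exists n, ball_coverable delta F n) ->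
  box_ratio F delta @[delta --> 0^'+] --> t -> (hausdorff_dim F <= t%:E)%E.
Proof.
move=> t0 Fcov Ft; apply/lee_addgt0Pr => e e0.
apply: ereal_inf_lbound; exists (t + e) => //; split; first lra.
apply/eqP; rewrite eq_le; apply/andP; split; last first.
  apply: (le_trans (hausdorff_premeasure_ge0 _ (t + e) 1 F)).
  by apply: ereal_sup_ubound; exists 1 => //=.
apply: ub_ereal_sup => _ [delta /= delta0 <-].
apply/lee_addgt0Pr => e' e'0; rewrite add0e.
have e2 : 0 < e / 2 by rewrite divr_gt0.
have p0 : 0 < (2 : R) `^ (t + e) by rewrite powR_gt0.
have q0 : 0 < e' / 2 `^ (t + e) by rewrite divr_gt0.
have small : \forall eta \near (0 : R)^'+,
    [/\ 0 < eta, eta < 1, 2 * eta <= delta, box_ratio F eta <= t + e / 2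
      & 2 `^ (t + e) * eta `^ (e / 2) <= e'].
  near=> eta; split.
  - by near: eta; exact: nbhs_right_gt.
  - by near: eta; exact: nbhs_right_lt.
  - rewrite mulrC -ler_pdivlMr//; near: eta; apply: nbhs_right_le.
    by rewrite divr_gt0.
  - near: eta; move/cvgrPdist_le/(_ _ e2): Ft; apply: filterS => x.
    by rewrite ler_norml => /andP[H _]; lra.
  - rewrite mulrC -ler_pdivlMr//.
    near: eta; move/cvgrPdist_le/(_ _ q0): (powR_cvg0 e2); apply: filterS => x.
    by rewrite sub0r normrN => /(le_trans (ler_norm _)).
have [eta [eta0 eta1 eta_delta ratio bound]] := @filter_ex _ _ _ _ small.
have [n Fn] := Fcov _ eta0.
have [{n}Fn _] := covering_numberP _ _ _ _ Fn.
have te0 : 0 <= t + e by lra.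
have [U FU Us] := ball_coverable_delta_cover _ _ _ _ _ te0 eta0 Fn.
apply: ge_ereal_inf; exists (\sum_(0 <= i <oo) diam_pow (t + e) (U i))%E.
  by exists U => //; exact: delta_cover_le FU.
apply: (le_trans Us); rewrite lee_fin; apply: le_trans bound.
have L0 : 0 < - ln eta by rewrite oppr_gt0 ln_lt0// eta0.
rewrite (powRM _ (ler0n _ 2) (ltW eta0)) mulrCA ler_wpM2l ?powR_ge0//.
(* The bound on N through [ln] requires N > 0. *)
have [->|N0] := posnP (covering_number eta F); first by rewrite mul0r powR_ge0.
have NE : (covering_number eta F)%:R <= eta `^ (- (t + e / 2)).
  rewrite -ler_ln ?posrE ?powR_gt0 ?ltr0n// ln_powR mulNr -mulrN.
  by rewrite -ler_pdivrMr.
apply: (le_trans (ler_wpM2r (powR_ge0 _ _) NE)).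
rewrite -powRD; last by apply/implyP => _; rewrite gt_eqF.
by rewrite (_ : - (t + e / 2) + (t + e) = e / 2)//; field.
Unshelve. all: by end_near. Qed.

(** The projection of U need not be measurable, so it is enclosed in an interval of radius u = diam
    U about one of its points; the length 2 u is at most 2 u^s because u <= 1 and s <= 1. *)
Lemma projection_measure_le d (i : 'I_d) (s : R) (U : set 'rV[R]_d) : 0 <= s <= 1 ->
  (ediam U <= 1)%E ->
  exists J : set R, [/\ measurable J, forall x, U x -> J (x 0 i)
    & (lebesgue_measure J <= 2%:E * diam_pow s U)%E].
Proof.
move=> /andP[s0 s1] U1; rewrite /diam_pow; case: ifPn => [/eqP ->|/set0P U0].
  by exists set0; split=> //; rewrite measure0 mule0.
have dU := ediam_ge0 _ _ U0.
have Ux x y : U x -> U y -> ((enorm (x - y))%:E <= ediam U)%E.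
  by move=> Hx Hy; apply: ereal_sup_ubound; exists x => //; exists y.
case: (ediam U) U1 dU Ux => // u; rewrite poweR_EFin !lee_fin => u1 u0 Ux.
have [c Uc] := U0.
exists [set` `[c 0 i - u, c 0 i + u]]; split => //.
- move=> x /Ux /(_ Uc); rewrite lee_fin => H.
  have := le_trans (coord_le_enorm _ _ i) H.
  by rewrite !mxE ler_norml /= in_itv/= => /andP[? ?]; apply/andP; split; lra.
- rewrite lebesgue_measure_itv/= lte_fin; case: ifPn => [cu|_]; last first.
    by rewrite -EFinM lee_fin mulr_ge0// powR_ge0.
  rewrite -EFinB -EFinM lee_fin.
  have u_gt0 : 0 < u by lra.
  by have := @ger1_powR R u s; rewrite u_gt0 u1 => /(_ isT s1); lra.
Qed.

(** Serves both lower bounds: s < 1 for the Hausdorff dimension, s = 1 for counting balls. *)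
Lemma projection_le_diam_pow_sum d (i : 'I_d) (s a b : R) (F : set 'rV[R]_d) U :
  0 <= s <= 1 -> a < b -> `[a, b] `<=` [set x 0 i | x in F] -> delta_cover 1 F U ->
  ((b - a)%:E <= 2%:E * \sum_(0 <= n <oo) diam_pow s (U n))%E.
Proof.
move=> s01 ab abF [FU U1].
have /choice[J HJ] n := projection_measure_le _ i _ _ s01 (U1 n).
have -> : (b - a)%:E = lebesgue_measure (`[a, b] : set R).
  by rewrite lebesgue_measure_itv/= lte_fin ab.
rewrite -nneseriesZl; last by move=> *; exact: diam_pow_ge0.
apply: (@le_trans _ _ (\sum_(0 <= n <oo) lebesgue_measure (J n))%E).
  apply: measure_sigma_subadditive => //; first by move=> n; have [] := HJ n.
  move=> y /abF[x /FU[n _ Ux] <-]; exists n => //.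
  by have [_ + _] := HJ n; apply.
by apply: lee_nneseries => n; [move=> *; exact: measure_ge0|have [] := HJ n].
Qed.

Lemma hausdorff_dim_ge1 d (i : 'I_d) (a b : R) (F : set 'rV[R]_d) :
  a < b -> `[a, b] `<=` [set x 0 i | x in F] -> (1 <= hausdorff_dim F)%E.
Proof.
move=> ab abF; apply: le_ereal_inf_tmp => _ [s [s0 Hs] <-].
rewrite lee_fin leNgt; apply/negP => s1.
(* The premeasure at scale 1 is below the measure, yet covers at that scale have sums at least (b -
   a) / 2. *)
have : (hausdorff_premeasure s 1 F <= 0)%E.
  by rewrite -Hs; apply: ereal_sup_ubound; exists 1 => //=.
apply/negP; rewrite -ltNge.
apply: (@lt_le_trans _ _ ((b - a) / 2)%:E).
  by rewrite lte_fin divr_gt0// subr_gt0.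
apply: le_ereal_inf_tmp => _ [U FU <-].
rewrite mulrC EFinM lee_pdivrMl//.
by apply: projection_le_diam_pow_sum abF FU => //; rewrite s0 ltW.
Qed.

(** The 4 combines the ball diameter 2 delta with the factor 2 lost in the projection. *)
Lemma projection_le_ball_coverable d (i : 'I_d) (a b delta : R) (F : set 'rV[R]_d) n :
  a < b -> `[a, b] `<=` [set x 0 i | x in F] -> 0 < delta -> 2 * delta <= 1 ->
  ball_coverable delta F n -> (b - a) / 4 <= n%:R * delta.
Proof.
move=> ab abF d0 d1 Fn.
have [U /(delta_cover_le _ _ _ _ _ d1) FU Us] :=
  ball_coverable_delta_cover _ _ 1 _ _ ler01 d0 Fn.
have s01 : 0 <= (1 : R) <= 1 by rewrite ler01 lexx.
have := projection_le_diam_pow_sum _ _ _ _ _ _ _ s01 ab abF FU.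
move=> /le_trans /(_ (lee_wpmul2l _ Us)) => /(_ (ltW (ltr0n _ 2))).
by rewrite -EFinM lee_fin powRr1; lra.
Qed.

Lemma ln_le_id (x : R) : 0 < x -> ln x <= x.
Proof.
move=> x0; have := @le_ln1Dx R (x - 1); rewrite (addrC 1) subrK => H.
by apply: le_trans (H _) _; lra.
Qed.

(* The factor n.+1 costs only ln (n.+1) = o(n) in the logarithm of the covering
   number; ln x <= eps * x - ln eps makes this quantitative. *)
Lemma box_ratio_cvg1 d (F : set 'rV[R]_d) (c delta0 : R) (K : nat) :
  0 < c -> 0 < delta0 ->
  (forall delta n, 0 < delta -> delta <= delta0 -> ball_coverable delta F n ->
     c <= n%:R * delta) ->
  (forall n, exists2 m, ball_coverable (4 / 2 ^+ n) F m & (m <= K * n.+1 * 2 ^ n)%N) ->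
  (forall delta : R, 0 < delta -> exists n, ball_coverable delta F n) /\
  box_ratio F delta @[delta --> 0^'+] --> (1 : R).
Proof.
move=> c0 delta00 Hlow Hup.
have ln2 : 0 < ln 2 :> R by rewrite ln_gt0// ltr1n.
have lnX2 n : ln (2 ^+ n) = n%:R * ln 2 :> R by rewrite lnXn// mulr_natl.
(* The truncation plus one exceeds log2 (1 / delta); the further 2 absorbs the 4 in 4 / 2^n. *)
pose scale (delta : R) := ((Num.truncn (- ln delta / ln 2)).+1 + 2)%N.
have scaleP delta : 0 < delta -> 4 / 2 ^+ scale delta <= delta.
  move=> d0; rewrite -ler_ln ?posrE ?divr_gt0 ?exprn_gt0//.
  rewrite ln_div ?posrE ?exprn_gt0//.
  rewrite (_ : 4 = 2 ^+ 2 :> R); last by rewrite -natrX.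
  rewrite !lnX2 /scale natrD.
  have := truncnS_gt (- ln delta / ln 2).
  by rewrite ltr_pdivrMr//; lra.
have scale_le delta : 0 < delta -> delta < 1 ->
    (scale delta)%:R <= - ln delta / ln 2 + 3.
  move=> d0 d1; rewrite /scale addSn -addnS natrD lerD2r truncn_le.
  by rewrite divr_ge0 ?(ltW ln2)// oppr_ge0 ln_le0 // ltW.
have cov delta : 0 < delta -> exists2 m, ball_coverable delta F m &
    (m <= K * (scale delta).+1 * 2 ^ scale delta)%N.
  move=> d0; have [m Fm mK] := Hup (scale delta).
  by exists m => //; apply: ball_coverable_le Fm; exact: scaleP.
split; first by move=> delta /cov[m]; exists m.
apply/cvgrPdist_le => e e0.
(* With L = - ln delta and n ln 2 <= L + 3 ln 2, this [eps] gives eps (n + 1) <= e L / 2 + 4 eps,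
   hence ln N <= L + e L / 2 + C. Once L > M, both C <= e L / 2 and - ln c <= e L. *)
pose eps := e / 2 * ln 2.
pose C : R := ln K%:R + 3 * ln 2 + 4 * eps - ln eps.
pose M := 2 * `|C| / e + `|ln c| / e + 1.
have eps0 : 0 < eps by rewrite mulr_gt0// divr_gt0.
have Me : M * e = 2 * `|C| + `|ln c| + e by rewrite /M; field; rewrite gt_eqF.
near=> delta.
have d0 : 0 < delta by near: delta; exact: nbhs_right_gt.
have d1 : delta < 1 by near: delta; exact: nbhs_right_lt.
have dd0 : delta <= delta0 by near: delta; exact: nbhs_right_le.
have dM : delta < expR (- M).
  by near: delta; apply: nbhs_right_lt; exact: expR_gt0.
have ML : M < - ln delta.
  by rewrite ltrNr -ltr_expR lnK// posrE.
have [m Fm mK] := cov _ d0.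
have [FN Nm] := covering_numberP _ _ _ _ Fm.
rewrite /box_ratio; move: (covering_number delta F) FN Nm => N FN Nm.
have cN := Hlow _ _ d0 dd0 FN.
have N0 : 0 < N%:R :> R by rewrite -(pmulr_lgt0 _ d0); exact: lt_le_trans cN.
(* Positivity of N forces K > 0, which makes ln K usable. *)
have bound0 : (0 < K * (scale delta).+1 * 2 ^ scale delta)%N.
  by apply: leq_trans mK; apply: leq_trans Nm; rewrite -(ltr0n R).
have K0 : (0 < K)%N by move: bound0; rewrite !muln_gt0 => /andP[/andP[]].
have lower : ln c - ln delta <= ln N%:R.
  by rewrite lerBlDr -lnM// ler_ln// posrE mulr_gt0.
have sle := scale_le _ d0 d1.
have upper : ln (N%:R : R) <= ln K%:R + ln (scale delta).+1%:R + (scale delta)%:R * ln 2.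
  rewrite -lnX2 -natrX -!lnM ?posrE ?mulr_gt0 ?ltr0n ?expn_gt0// -!natrM.
  by rewrite ler_ln ?posrE// ?ltr0n// ler_nat (leq_trans Nm).
have upper2 := ln_le_id (eps * (scale delta).+1%:R).
rewrite lnM ?posrE ?ltr0n// in upper2.
have {}upper2 := upper2 (mulr_gt0 eps0 (ltr0Sn _ _)).
move: (scale delta) sle upper upper2 => n sle upper upper2.
move: (- ln delta) (ln c) Me ML lower sle => L lc Me ML lower sle.
have eL : 2 * `|C| + `|lc| + e < L * e.
  by rewrite -Me ltr_pM2r.
have C0 := normr_ge0 C; have lc0 := normr_ge0 lc.
have L0 : 0 < L by rewrite -(pmulr_lgt0 _ e0); lra.
have n2 : n%:R * ln 2 <= L + 3 * ln 2.
  by move: sle; rewrite -(ler_pM2r ln2) mulrDl divfK// gt_eqF.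
have en2 : eps * n.+1%:R <= e * L / 2 + 4 * eps.
  have : e / 2 * (n%:R * ln 2) <= e / 2 * (L + 3 * ln 2).
    by rewrite ler_pM2l// divr_gt0.
  by rewrite -(natr1 n) /eps; lra.
have CC := ler_norm C; have lcc := ler_norm (- lc); rewrite normrN in lcc.
rewrite (_ : 1 - ln N%:R / L = (L - ln N%:R) / L); last by field; rewrite gt_eqF.
rewrite normrM normfV (gtr0_norm L0) ler_pdivrMr// ler_norml.
by rewrite /C in eL CC; apply/andP; split; lra.
Unshelve. all: by end_near. Qed.

End Dimensions.

Theorem theorem3p2 (R : realType) :
  let G : set 'rV[R]_2 := graph_on xi `[2^-1, 1] in
  [/\ box_dim_exists G, hausdorff_dim G = 1%:E & box_dim G = 1].
Proof.
move=> G.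
have half_lt1 : 2^-1 < 1 :> R by rewrite invf_lt1// ltr1n.
have proj : `[2^-1, 1] `<=` [set x 0 ord0 | x in G].
  move=> y yI; exists (\row_(i < 2) (if i == 0 then y else xi y)); first by exists y.
  by rewrite mxE.
have [K HK] := @xi_diff_le R.
have [Gcov Gbox] : (forall delta : R, 0 < delta -> exists n, ball_coverable delta G n) /\
    box_ratio G delta @[delta --> 0^'+] --> (1 : R).
  (* The threshold 1/2 ensures 2 delta <= 1, and 2 K + 1 comes from 2 K (n + 1) + 1 <= (2 K + 1) (n
     + 1). *)
  apply: (@box_ratio_cvg1 _ _ _ ((1 - 2^-1) / 4) 2^-1 (2 * K + 1)%N).
  - by rewrite divr_gt0// subr_gt0.
  - by rewrite invr_gt0.
  - move=> delta n d0 d2.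
    by apply: projection_le_ball_coverable half_lt1 proj d0 _; lra.
  (* The labels are the 2^n digit prefixes of length n. *)
  - move=> n; pose label (x : R) := [ffun k : 'I_n => digits x k].
    have := @graph_ball_coverable R {ffun 'I_n -> bool} label xi `[2^-1, 1]
      (2 / 2 ^+ n) (K * n.+1).
    rewrite (_ : 2 * (2 / 2 ^+ n) = 4 / 2 ^+ n); last by rewrite mulrA -natrM.
    rewrite card_ffun card_bool card_ord => H.
    exists (2 ^ n * (K * n.+1).*2.+1)%N; last by nia.
    apply: H; first by rewrite divr_gt0// exprn_gt0.
    move=> x y; rewrite /= !in_itv/= => xI yI /ffunP xy; apply: HK => // k kn.
    by have := xy (Ordinal kn); rewrite !ffunE.
split.
- by apply/cvg_ex; exists 1.
- apply/eqP; rewrite eq_le (hausdorff_dim_le_box_dim _ _ _ ler01 Gcov Gbox)/=.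
  exact: hausdorff_dim_ge1 half_lt1 proj.
- exact: cvg_lim Gbox.
Qed.
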